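(* Let $K=[-1,1]\times[0,1]\times[0,1]$ with generic point $\varpi=(w,p,q)$, let $\alpha_0\in(0,1]$ and $\varepsilon_0>0$, and let $$ f_0=\alpha_0 f_0^0+(1-\alpha_0)f_0^1, $$ where $f_0^0\in P(K)$ is supported in $\{q=0\}$ and $f_0^1\in P(K)$ is supported in $\{q\ge\varepsilon_0\}$. Let $\langle p\rangle_{|q=0}:=\int_K p\,df_0^0$, assume $\langle p\rangle_{|q=0}>0$, and put $$ m_0^0:=\int_K\frac{p}{\langle p\rangle_{|q=0}}\,w\,df_0^0(\varpi). $$ Assume that the map $(p,q)\in[0,1]\times[\varepsilon_0,1]\mapsto f^1_{0|(p,q)}\in P([-1,1])$ (the conditional distribution of $w$ given $(p,q)$ under $f_0^1$) is globally Lipschitz for the $W_1$-distance: there exists $L>0$ such that for any $(p,q),(p',q')\in[0,1]\times[\varepsilon_0,1]$, $$ W_1\big(f^1_{0|(p,q)},f^1_{0|(p',q')}\big)\le L\,(|q-q'|+|p-p'|). $$ Let $f\in C([0,+\infty),P(K))$ be the solution, with initial condition $f_0$, of the nonlocal transport equation $\partial_t f_t+\partial_w\big((m(t)-w)\,q\,\langle p\rangle f_t\big)=0$, and let $f_t^1$ be its non-stubborn part, so that $f_t=\alpha_0f_0^0+(1-\alpha_0)f_t^1$ (see context for the precise definitions). Then for every $t\ge0$, $$ W_1\big(f_t^1,\ \delta_{m_0^0}\otimes f_0^1(p,q)\,dp\,dq\big)\le 4\,e^{-\alpha_0\varepsilon_0\langle p\rangle_{|q=0}\,t}, $$ where $f_0^1(p,q)\,dp\,dq$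 denotes the marginal of $f_0^1$ in the variables $(p,q)$ and $\delta_{m_0^0}$ is the Dirac mass at $m_0^0$ in the variable $w$.
   Context: $P(X)$ is the set of Borel probability measures on a compact metric space $X$; here $P(K)$ and $P([-1,1])$ carry the topology of weak convergence. The Wasserstein distance $W_1(\mu,\nu)$ is the infimum of $\int |x-y|\,d\alpha(x,y)$ over couplings $\alpha$ of $\mu$ and $\nu$; equivalently, it is the supremum of $\int\varphi\,d(\mu-\nu)$ over $1$-Lipschitz $\varphi$. The notation $f(\varpi)d\varpi$ or $f_0^1(p,q)dpdq$ does not mean the measures have densities. Transport equation: given $f_0\in P(K)$, put $\langle p\rangle=\int_K p\,df_0$ and, for $f\in C([0,+\infty),P(K))$, $m(t)=\int_K\frac{p}{\langle p\rangle}w\,df_t(\varpi)$. Then $f$ solves $\partial_tf+\partial_w((m(t)-w)q\langle p\rangle f)=0$ with initial condition $f_0$ if for all $\phi\in C^\infty(K)$ and $t\ge0$, $$\int_K\phi\,df_t=\int_K\phi\,df_0+\int_0^t\int_K(m(s)-w)\langle p\rangle\,q\,\partial_w\phi(\varpi)\,df_s(\varpi)\,ds.$$ This equation has a unique solution in $C([0,+\infty),P(K))$ for every initial datum with $\langle p\rangle>0$. Non-stubborn part: $f^1_t\in P(K)$ denotes the evolution of $f_0^1$, i.e. $f^1\in C([0,+\infty),P(K))$, with $f^1_{t=0}=f_0^1$, is the weak solution of $\partial_tf^1_t+\partial_w((m(t)-w)q\langle p\rangle f^1_t)=0$, where $m(t)$ and $\langle p\rangle$ are those computed from the full solution $f$.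 One has $f_t=\alpha_0f_0^0+(1-\alpha_0)f_t^1$, since agents with $q=0$ do not move; for $\alpha_0<1$ this identity determines $f^1_t$. Conditional distribution: for $\mu\in P(K)$ with marginal $\mu_1$ in $(p,q)$, $\mu_{|(p,q)}\in P([-1,1])$ is a measurable family with $\int_K\phi\,d\mu=\int\big(\int_{-1}^1\phi(w,p,q)\,d\mu_{|(p,q)}(w)\big)d\mu_1(p,q)$ for $\phi\in C(K)$. The Lipschitz hypothesis is understood as the existence of a version of $f^1_{0|(p,q)}$, defined on $[0,1]\times[\varepsilon_0,1]$, with the stated property. *)

(* Defs.v *)
From HB Require Import structures.
From mathcomp Require Import all_boot all_order all_algebra.
From mathcomp Require Import all_classical all_reals all_analysis.
From mathcomp Require Import measurable_realfun.

Set Implicit Arguments.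
Unset Strict Implicit.
Unset Printing Implicit Defensive.

Import Order.TTheory GRing.Theory Num.Theory.
Import numFieldNormedType.Exports.

Local Open Scope classical_set_scope.
Local Open Scope ring_scope.

(* A generic point is varpi = (w, (p, q)); the product sigma-algebra on
   [R * (R * R)] is the Borel one. *)
Notation state R := (R * (R * R))%type.

Definition K {R : realType} : set (state R) :=
  [set x | -1 <= x.1 <= 1 /\ 0 <= x.2.1 <= 1 /\ 0 <= x.2.2 <= 1].

(* For a closed set A this says that the support of mu is included in A.
   Elements of P(A) are encoded as probability measures on the ambient space
   that are supported in A. *)
Definition supported_in d (T : measurableType d) (R : realType)
  (mu : probability T R) (A : set T) : Prop := mu (~` A) = 0%E.

Definition is_coupling d (T : measurableType d) (R : realType)
    (mu nu : set T -> \bar R) (a : probability (T * T)%type R) : Prop :=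
  forall A : set T, measurable A ->
    pushforward a fst A = mu A /\ pushforward a snd A = nu A.

Definition W1 d (T : measurableType d) (R : realType) (dist : T -> T -> R)
    (mu nu : set T -> \bar R) : \bar R :=
  ereal_inf [set (\int[a]_z (dist z.1 z.2)%:E)%E |
             a in [set a : probability (T * T)%type R | is_coupling mu nu a]].

Definition dist1 {R : realType} (w w' : R) : R := `|w - w'|.

(* The norm that the library puts on products is the max norm, hence the
   explicit Euclidean distance. *)
Definition dist3 {R : realType} (x y : state R) : R :=
  Num.sqrt ((x.1 - y.1) ^+ 2 + (x.2.1 - y.2.1) ^+ 2 + (x.2.2 - y.2.2) ^+ 2).

Definition D_w (R : realType) (phi : state R -> R) : state R -> R :=
  fun x => 'D_((1, (0, 0)) : state R) phi x.
Definition D_p (R : realType) (phi : state R -> R) : state R -> R :=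
  fun x => 'D_((0, (1, 0)) : state R) phi x.
Definition D_q (R : realType) (phi : state R -> R) : state R -> R :=
  fun x => 'D_((0, (0, 1)) : state R) phi x.

Definition partially_derivable (R : realType) (phi : state R -> R) : Prop :=
  forall x : state R,
    [/\ derivable phi x ((1, (0, 0)) : state R),
        derivable phi x ((0, (1, 0)) : state R) &
        derivable phi x ((0, (0, 1)) : state R)].

Fixpoint Ck (R : realType) (n : nat) (phi : state R -> R) : Prop :=
  match n with
  | 0%N => continuous phi
  | n'.+1 => [/\ continuous phi, partially_derivable phi &
                 [/\ Ck n' (D_w phi), Ck n' (D_p phi) & Ck n' (D_q phi)]]
  end.

(* Elements of C^oo(K) are the restrictions to K of these functions. *)
Definition smooth (R : realType) (phi : state R -> R) : Prop :=
  forall n, Ck n phi.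

(* C([0,+oo), P(K)) for the weak topology. Only the values at t >= 0 of a
   curve [g : R -> probability _ R] matter. *)
Definition weak_curve (R : realType) (g : R -> probability (state R) R) : Prop :=
  (forall t, 0 <= t -> supported_in (g t) K) /\
  (forall phi : state R -> R, {within K, continuous phi} ->
     {within `[0, +oo[, continuous (fun t : R => \int[g t]_(x in K) phi x)}).

Definition mean_p (R : realType) (mu : probability (state R) R) : R :=
  \int[mu]_(x in K) x.2.1.

Definition weighted_opinion (R : realType) (c : R) (mu : probability (state R) R) : R :=
  \int[mu]_(x in K) (x.2.1 / c * x.1).

(* Weak solution in C([0,+oo), P(K)), with initial condition g0, of
   d_t g + d_w ((m(t) - w) q c g) = 0, for a given function m and constant c.
   Taking t = 0 shows that g 0 = g0. *)
Definition weak_solution (R : realType) (c : R) (m : R -> R)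
    (g0 : probability (state R) R) (g : R -> probability (state R) R) : Prop :=
  weak_curve g /\
  (forall (phi : state R -> R) (t : R), smooth phi -> 0 <= t ->
     \int[g t]_(x in K) phi x =
     \int[g0]_(x in K) phi x +
     \int[lebesgue_measure]_(s in `[0, t])
       \int[g s]_(x in K) ((m s - x.1) * c * x.2.2 * D_w phi x)).

Definition transport_solution (R : realType)
    (f0 : probability (state R) R) (f : R -> probability (state R) R) : Prop :=
  weak_solution (mean_p f0) (fun t => weighted_opinion (mean_p f0) (f t)) f0 f.

(* f1 is the evolution of f01 in the velocity field of the full solution f. *)
Definition nonstubborn_part (R : realType)
    (f0 : probability (state R) R) (f : R -> probability (state R) R)
    (f01 : probability (state R) R) (f1 : R -> probability (state R) R) : Prop :=
  weak_solution (mean_p f0) (fun t => weighted_opinion (mean_p f0) (f t)) f01 f1.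

Definition mixture d (T : measurableType d) (R : realType) (a : R)
    (mu nu rho : probability T R) : Prop :=
  forall A : set T, measurable A ->
    rho A = (a%:E * mu A + (1 - a)%:E * nu A)%E.

HB.instance Definition _ d1 d2 (T1 : measurableType d1) (T2 : measurableType d2) :=
  isMeasurableFun.Build _ _ (T1 * T2)%type T2 snd measurable_snd.

Definition marginal_pq (R : realType) (mu : probability (state R) R) :
    probability (R * R)%type R :=
  distribution mu (snd : {mfun state R >-> (R * R)%type}).

(* kappa is a version, defined on D, of the conditional distribution of w
   given (p, q) under mu. *)
Definition is_conditional (R : realType) (mu : probability (state R) R)
    (D : set (R * R)) (kappa : R * R -> probability R R) : Prop :=
  [/\ forall pq, D pq -> supported_in (kappa pq) `[-1, 1],
      forall A : set R, measurable A -> measurable_fun D (fun pq => kappa pq A) &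
      forall phi : state R -> R, {within K, continuous phi} ->
        \int[mu]_(x in K) phi x =
        \int[marginal_pq mu]_(pq in D)
          \int[kappa pq]_(w in `[-1, 1]) phi (w, pq)].

(* Main.v *)
Require Import Defs.
From HB Require Import structures.
From mathcomp Require Import all_boot all_order all_algebra.
From mathcomp Require Import all_classical all_reals all_analysis.
From mathcomp Require Import measurable_realfun.
From mathcomp Require Import ring.
Import Order.TTheory GRing.Theory Num.Theory.
Import numFieldNormedType.Exports.
Local Open Scope classical_set_scope.
Local Open Scope ring_scope.

(* Put [u = w - m_0^0] and let [M_N] be the integral of [u ^ N] against [f^1_t],
   [N] even. Testing the equation with [u ^ N] gives [M_N'] as a double integral
   over two independent agents, because [c (m - m_0^0)], with [c = <p>], is
   [1 - alpha_0] times the integral of [p u] against [f^1_t]. Young's inequality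
   [N u' u ^ (N - 1) <= u' ^ N + (N - 1) u ^ N] bounds it by
   [(1 - N lambda) M_N], where [lambda = alpha_0 eps_0 <p>_{|q=0}] (the loss 1
   does not grow with [N]), so that [M_N(t) <= 2 ^ N e ^ (t - N lambda t)]. For
   [N] with [e ^ t <= 2 ^ N] this makes the mean of [|u|] at most
   [4 e ^ (- lambda t)], and that mean is the cost of moving every agent to
   [m_0^0] with [(p, q)] kept fixed.

   That [(p, q)] has a constant law follows from testing with smooth
   approximations of indicators of quadrants. The decomposition of [f_t] is only
   needed for the integral of [p w]: the defects [H_k] in the integrals of
   [p w q ^ k] satisfy [H_k' = - c H_(k+1)] and [H_k(0) = 0], and are bounded
   uniformly in [k], hence vanish. *)

Set Implicit Arguments.
Unset Strict Implicit.
Unset Printing Implicit Defensive.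

(** * Smooth test functions *)

Definition smooth1 (R : realType) (a : R -> R) : Prop :=
  exists2 S : set (R -> R), S a &
    forall g, S g -> exists2 g', S g' & forall x : R, is_derive x 1 g (g' x).

Definition tensor (R : realType) (a b d : R -> R) : state R -> R :=
  fun x => a x.1 * b x.2.1 * d x.2.2.

Lemma is_derive_along_line (R : realType) (phi : state R -> R) (g : R -> R)
    (x v : state R) (y dg : R) :
  (forall h : R, phi (h *: v + x) = g (h + y)) ->
  is_derive y 1 g dg -> is_derive x v phi dg.
Proof.
move=> phig [dgy <-].
have E : (fun h => h^-1 *: ((phi \o shift x) (h *: v) - phi x)) =
         (fun h => h^-1 *: ((g \o shift y) (h *: 1) - g y)).
  apply/funext => h /=; rewrite phig -{1}(add0r x) -(scale0r v) phig add0r.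
  by rewrite /= [h *: 1]mulr1.
split; first by rewrite /derivable E.
by rewrite /derive E.
Qed.

Lemma is_derive_tensor_w (R : realType) (a b d : R -> R) (da : R) (x : state R) :
  is_derive x.1 1 a da ->
  is_derive x ((1, (0, 0)) : state R) (tensor a b d) (da * b x.2.1 * d x.2.2).
Proof.
case: x => w [p q] /= Da.
have Dg : is_derive w 1 ((b p * d q) *: a) (da * b p * d q).
  by apply: is_derive_eq; rewrite [_ *: _]mulrC mulrA.
apply: (is_derive_along_line _ Dg) => h.
by rewrite /tensor fctE /= [h *: 1]mulr1 !scaler0 !add0r [RHS]mulrC mulrA.
Qed.

Lemma is_derive_tensor_p (R : realType) (a b d : R -> R) (db : R) (x : state R) :
  is_derive x.2.1 1 b db ->
  is_derive x ((0, (1, 0)) : state R) (tensor a b d) (a x.1 * db * d x.2.2).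
Proof.
case: x => w [p q] /= Db.
have Dg : is_derive p 1 ((a w * d q) *: b) (a w * db * d q).
  by apply: is_derive_eq; rewrite [_ *: _]mulrAC.
apply: (is_derive_along_line _ Dg) => h.
by rewrite /tensor fctE /= [h *: 1]mulr1 !scaler0 !add0r [RHS]mulrAC.
Qed.

Lemma is_derive_tensor_q (R : realType) (a b d : R -> R) (dd : R) (x : state R) :
  is_derive x.2.2 1 d dd ->
  is_derive x ((0, (0, 1)) : state R) (tensor a b d) (a x.1 * b x.2.1 * dd).
Proof.
case: x => w [p q] /= Dd.
have Dg : is_derive q 1 ((a w * b p) *: d) (a w * b p * dd).
  by apply: is_derive_eq.
apply: (is_derive_along_line _ Dg) => h.
by rewrite /tensor fctE /= [h *: 1]mulr1 !scaler0 !add0r.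
Qed.

Lemma tensor_continuous (R : realType) (a b d : R -> R) :
  continuous a -> continuous b -> continuous d -> continuous (tensor a b d).
Proof.
move=> ca cb cd x; rewrite /tensor.
have c1 : {for x, continuous (fst : state R -> R)} by exact: cvg_fst.
have c2 : {for x, continuous (snd : state R -> R * R)} by exact: cvg_snd.
have c21 : {for x, continuous (fun y : state R => y.2.1)}.
  by apply: (continuous_comp c2); exact: cvg_fst.
have c22 : {for x, continuous (fun y : state R => y.2.2)}.
  by apply: (continuous_comp c2); exact: cvg_snd.
apply: cvgM; first apply: cvgM.
- exact: (continuous_comp c1 (ca _)).
- exact: (continuous_comp c21 (cb _)).
- exact: (continuous_comp c22 (cd _)).
Qed.

Lemma D_w_tensor (R : realType) (a b d : R -> R) (a' : R -> R) :
  (forall x : R, is_derive x 1 a (a' x)) ->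
  D_w (tensor a b d) = tensor a' b d.
Proof.
by move=> Da; apply/funext => x; have [] := is_derive_tensor_w (x := x) b d (Da _).
Qed.

Lemma smooth1_continuous (R : realType) (a : R -> R) : smooth1 a -> continuous a.
Proof.
move=> [S Sa H]; have [a' _ Da] := H _ Sa => x.
by apply/differentiable_continuous/derivable1_diffP; case: (Da x).
Qed.

Lemma smooth_tensor (R : realType) (a b d : R -> R) :
  smooth1 a -> smooth1 b -> smooth1 d -> smooth (tensor a b d).
Proof.
move=> [Sa Saa Ha] [Sb Sbb Hb] [Sd Sdd Hd] n.
elim: n a b d Saa Sbb Sdd => [|n IH] a b d Saa Sbb Sdd;
  have [a' Sa' Da] := Ha _ Saa; have [b' Sb' Db] := Hb _ Sbb;
  have [d' Sd' Dd] := Hd _ Sdd;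
  have ct : continuous (tensor a b d)
    by apply: tensor_continuous; apply: smooth1_continuous;
       [exists Sa|exists Sb|exists Sd].
  exact: ct.
split => //.
  by move=> x; split;
    [have [] := is_derive_tensor_w (x := x) b d (Da _)
    |have [] := is_derive_tensor_p (x := x) a d (Db _)
    |have [] := is_derive_tensor_q (x := x) a b (Dd _)].
rewrite (D_w_tensor _ _ Da).
have -> : D_p (tensor a b d) = tensor a b' d.
  by apply/funext => x; have [] := is_derive_tensor_p (x := x) a d (Db _).
have -> : D_q (tensor a b d) = tensor a b d'.
  by apply/funext => x; have [] := is_derive_tensor_q (x := x) a b (Dd _).
by split; exact: IH.
Qed.

Lemma smooth1_horner (R : realType) (P : {poly R}) : smooth1 (horner P).
Proof.
exists [set g | exists Q : {poly R}, g = horner Q]; first by exists P.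
move=> _ [Q ->]; exists (horner Q^`()); first by exists Q^`().
by move=> x; exact: is_derive_poly.
Qed.

(* Smooth, with values in [0, 1], and pointwise convergent for [n -> oo] to the
   indicator of [x < c], the point [x = c] included. *)
Definition soft_step (R : realType) (c : R) (n : nat) : R -> R :=
  fun x => expR (- (n%:R * expR (n%:R * (x - c)))).

Lemma smooth1_soft_step (R : realType) (c : R) (n : nat) :
  smooth1 (soft_step c n).
Proof.
pose e x : R := expR (n%:R * (x - c)).
exists [set g | exists Q : {poly R}, g = (fun x => Q.[e x] * soft_step c n x)].
  by exists 1; apply/funext => x; rewrite hornerC mul1r.
move=> _ [Q ->].
have De (x : R) : is_derive x 1 e (n%:R * e x).
  have Dl : is_derive x 1 (horner (n%:R%:P * ('X - c%:P))) n%:R.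
    apply: is_derive_eq; rewrite derivM derivB derivC derivX !derivC mul0r add0r.
    by rewrite subr0 mulr1 hornerC.
  have -> : e = expR \o horner (n%:R%:P * ('X - c%:P)).
    by apply/funext => y; congr (expR _); rewrite !hornerE.
  by apply: is_derive_eq; rewrite /= mulrC.
have Ds (x : R) :
    is_derive x 1 (soft_step c n) (- n%:R * (n%:R * e x) * soft_step c n x).
  have -> : soft_step c n = expR \o (- n%:R *: e).
    by apply/funext => y; rewrite /soft_step /= fctE /= [_ *: _]mulNr.
  by apply: is_derive_eq; rewrite /= mulrC.
exists (fun x => (n%:R%:P * 'X * Q^`() - (n%:R ^+ 2)%:P * 'X * Q).[e x] *
                 soft_step c n x).
  by eexists.
move=> x.
have DQ : is_derive x 1 (horner Q \o e) (Q^`().[e x] * (n%:R * e x)).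
  by apply: is_derive_eq.
have := is_deriveM DQ (Ds x).
move=> H; apply: (@is_derive_eq _ _ _ _ _ _ _ _ H).
rewrite hornerD hornerN !hornerM !hornerC hornerX /GRing.scale /=; ring.
Qed.

(** * Integration over K *)

Lemma is_derive_Rintegral_halfline (R : realType) (G F : R -> R) (G0 : R) :
  {within `[0, +oo[, continuous F} ->
  (forall t : R, 0 <= t -> G t = G0 + \int[lebesgue_measure]_(s in `[0, t]) F s) ->
  forall t : R, 0 < t -> is_derive t 1 G (F t).
Proof.
move=> cF GE t t0.
have tt1 : t < t + 1 by rewrite ltrDl.
have iF : lebesgue_measure.-integrable `[0, t + 1] (EFin \o F).
  apply: continuous_compact_integrable; first exact: segment_compact.
  apply: continuous_subspaceW cF => x /=; rewrite !in_itv /= andbT.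
  by case/andP.
have cFt : {for t, continuous F}.
  have : {in `]0, +oo[%classic, continuous F}.
    rewrite -continuous_open_subspace; last exact: interval_open.
    apply: continuous_subspaceW cF => x /=; rewrite !in_itv /= !andbT.
    exact: ltW.
  by apply; rewrite inE /= in_itv /= t0.
have [dF F'] := continuous_FTC1_closed tt1 iF t0 cFt.
have Dint : is_derive t 1
    (fun x : R => G0 + \int[lebesgue_measure]_(s in `[0, x]) F s) (F t).
  rewrite -[X in is_derive _ _ _ X]add0r.
  by apply: is_deriveD; rewrite -F' derive1E; exact/derivableP.
apply: near_eq_is_derive Dint; near=> x; rewrite GE//.
by apply: ltW; near: x; exact: lt_nbhsr.
Unshelve. all: by end_near. Qed.

Lemma halfline_nondecreasing (R : realType) (G g : R -> R) :
  {within `[0, +oo[, continuous G} ->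
  (forall t : R, 0 < t -> is_derive t 1 G (g t)) ->
  (forall t : R, 0 < t -> 0 <= g t) ->
  forall t : R, 0 <= t -> G 0 <= G t.
Proof.
move=> cG dG g0 t t0.
apply: (@ger0_derive1_le_cc R G 0 t) => //.
- by move=> x; rewrite in_itv /= => /andP[/dG[]].
- move=> x; rewrite in_itv /= => /andP[x0 _].
  by rewrite derive1E; have [_ ->] := dG _ x0; exact: g0.
- apply: continuous_subspaceW cG => x /=; rewrite !in_itv /= andbT.
  by case/andP.
- by rewrite in_itv /= lexx.
- by rewrite in_itv /= lexx andbT.
Qed.

Lemma K_setX (R : realType) : @K R = `[-1, 1] `*` (`[0, 1] `*` `[0, 1]).
Proof.
by apply/seteqP; split => -[w [p q]]; rewrite /K /= !in_itv.
Qed.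

Lemma K_compact (R : realType) : compact (@K R).
Proof.
by rewrite K_setX; apply: compact_setX;
  [|apply: compact_setX]; exact: segment_compact.
Qed.

Lemma K_measurable (R : realType) : measurable (@K R).
Proof. by rewrite K_setX; apply: measurableX => //; exact: measurableX. Qed.

Definition cmeas (R : realType) (phi : state R -> R) : Prop :=
  continuous phi /\ measurable_fun setT phi.

Section cmeas_theory.
Context {R : realType}.
Implicit Types (phi psi : state R -> R) (mu : probability (state R) R).

Lemma cmeas_cst (c : R) : cmeas (fun _ : state R => c).
Proof. by split; [move=> x; exact: cst_continuous|exact: measurable_cst]. Qed.

Lemma cmeas_w : cmeas (fun x : state R => x.1).
Proof. by split; [move=> x; exact: cvg_fst|exact: measurable_fst]. Qed.

Lemma cmeas_p : cmeas (fun x : state R => x.2.1).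
Proof.
split; last exact: (measurableT_comp measurable_fst measurable_snd).
by move=> x; apply: continuous_comp; [exact: cvg_snd|exact: cvg_fst].
Qed.

Lemma cmeas_q : cmeas (fun x : state R => x.2.2).
Proof.
split; last exact: (measurableT_comp measurable_snd measurable_snd).
by move=> x; apply: continuous_comp; [exact: cvg_snd|exact: cvg_snd].
Qed.

Lemma cmeasD phi psi :
  cmeas phi -> cmeas psi -> cmeas (fun x => phi x + psi x).
Proof.
move=> [c1 m1] [c2 m2]; split; last exact: measurable_funD.
by move=> x; apply: cvgD; [exact: c1|exact: c2].
Qed.

Lemma cmeasM phi psi :
  cmeas phi -> cmeas psi -> cmeas (fun x => phi x * psi x).
Proof.
move=> [c1 m1] [c2 m2]; split; last exact: measurable_funM.
by move=> x; apply: cvgM; [exact: c1|exact: c2].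
Qed.

Lemma cmeasB phi psi :
  cmeas phi -> cmeas psi -> cmeas (fun x => phi x - psi x).
Proof.
move=> [c1 m1] [c2 m2]; split; last exact: measurable_funB.
by move=> x; apply: cvgB; [exact: c1|exact: c2].
Qed.

Lemma cmeas_comp (a : R -> R) phi :
  continuous a -> cmeas phi -> cmeas (fun x => a (phi x)).
Proof.
move=> ca [c1 m1]; split.
  by move=> x; apply: continuous_comp; [exact: c1|exact: ca].
exact: (measurableT_comp (continuous_measurable_fun ca) m1).
Qed.

Lemma cmeasX n phi : cmeas phi -> cmeas (fun x => phi x ^+ n).
Proof.
move=> nphi; apply: (cmeas_comp (a := fun y => y ^+ n)) => //.
exact: exprn_continuous.
Qed.

Lemma cmeas_norm phi : cmeas phi -> cmeas (fun x => `|phi x|).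
Proof.
move=> nphi; apply: (cmeas_comp (a := Num.norm)) => //.
exact: norm_continuous.
Qed.

Lemma cmeas_tensor (a b d : R -> R) :
  continuous a -> continuous b -> continuous d -> cmeas (tensor a b d).
Proof.
move=> ca cb cd; rewrite /tensor; apply: cmeasM; first apply: cmeasM.
- exact: (cmeas_comp ca cmeas_w).
- exact: (cmeas_comp cb cmeas_p).
- exact: (cmeas_comp cd cmeas_q).
Qed.

Lemma cmeas_bounded phi : cmeas phi ->
  exists2 B, 0 <= B & forall x, K x -> `|phi x| <= B.
Proof.
move=> [cphi _].
have : compact (phi @` K).
  apply: continuous_compact (@K_compact R).
  exact: continuous_subspaceT.
move=> /compact_bounded [M [Mr MB]].
exists (`|M| + 1) => [|x Kx]; first by rewrite addr_ge0.
by apply: (MB (`|M| + 1)); [rewrite ltr_pwDr// ler_norm|exists x].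
Qed.

Lemma integrable_cmeas mu phi : cmeas phi -> mu.-integrable K (EFin \o phi).
Proof.
move=> nphi; have [B B0 phiB] := cmeas_bounded nphi.
apply: measurable_bounded_integrable.
- exact: K_measurable.
- exact: le_lt_trans (probability_le1 _ (@K_measurable R)) (ltry 1).
- by apply: measurable_funTS; case: nphi.
- exists B; split; first by rewrite num_real.
  by move=> M BM x Kx; exact: le_trans (phiB _ Kx) (ltW BM).
Qed.

Lemma KintD mu phi psi : cmeas phi -> cmeas psi ->
  \int[mu]_(x in K) (phi x + psi x) =
  \int[mu]_(x in K) phi x + \int[mu]_(x in K) psi x.
Proof.
by move=> n1 n2; apply: RintegralD; [exact: K_measurable|exact: integrable_cmeas..].
Qed.

Lemma KintB mu phi psi : cmeas phi -> cmeas psi ->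
  \int[mu]_(x in K) (phi x - psi x) =
  \int[mu]_(x in K) phi x - \int[mu]_(x in K) psi x.
Proof.
by move=> n1 n2; apply: RintegralB; [exact: K_measurable|exact: integrable_cmeas..].
Qed.

Lemma KintZ mu (c : R) phi : cmeas phi ->
  \int[mu]_(x in K) (c * phi x) = c * \int[mu]_(x in K) phi x.
Proof.
by move=> n1; apply: RintegralZl; [exact: K_measurable|exact: integrable_cmeas].
Qed.

Lemma le_Kint mu phi psi : cmeas phi -> cmeas psi ->
  (forall x, K x -> phi x <= psi x) ->
  \int[mu]_(x in K) phi x <= \int[mu]_(x in K) psi x.
Proof.
by move=> n1 n2; apply: le_Rintegral; [exact: K_measurable|exact: integrable_cmeas..].
Qed.

Lemma Kint_cst mu (c : R) : supported_in mu K -> \int[mu]_(x in K) c = c.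
Proof.
move=> sK; rewrite Rintegral_cst; last exact: K_measurable.
have muK : mu K = 1%E.
  have := probability_setC mu (measurableC (@K_measurable R)).
  by rewrite setCK sK sube0.
by rewrite -[RHS]mulr1; congr (_ * _); exact: (congr1 fine muK).
Qed.

Lemma norm_Kint_le mu phi B : supported_in mu K -> cmeas phi ->
  (forall x, K x -> `|phi x| <= B) -> `|\int[mu]_(x in K) phi x| <= B.
Proof.
move=> sK nphi phiB.
apply: le_trans (le_normr_Rintegral (@K_measurable R) (integrable_cmeas mu nphi)) _.
rewrite -[leRHS](Kint_cst _ sK); apply: le_Kint => //.
  exact: cmeas_norm.
exact: cmeas_cst.
Qed.

Lemma Kint_ge0_supp mu phi (A : set (state R)) : measurable A -> supported_in mu A ->
  cmeas phi -> (forall x, K x -> A x -> 0 <= phi x) ->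
  0 <= \int[mu]_(x in K) phi x.
Proof.
move=> mA sA nphi phi0.
rewrite /Rintegral (negligible_integral (measurableC mA) (@K_measurable R) _ sA).
  apply: fine_ge0; apply: integral_ge0 => x [Kx /contrapT Ax].
  by rewrite lee_fin phi0.
exact: integrable_cmeas.
Qed.

Lemma le_Kint_supp mu phi psi (A : set (state R)) :
  measurable A -> supported_in mu A -> cmeas phi -> cmeas psi ->
  (forall x, K x -> A x -> phi x <= psi x) ->
  \int[mu]_(x in K) phi x <= \int[mu]_(x in K) psi x.
Proof.
move=> mA sA n1 n2 le12; rewrite -subr_ge0 -KintB//.
apply: Kint_ge0_supp mA sA _ _ => [|x Kx Ax]; first exact: cmeasB.
by rewrite subr_ge0 le12.
Qed.

Lemma Kint_mixture (a : R) (mu nu rho : probability (state R) R) phi :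
  0 <= a <= 1 -> mixture a mu nu rho -> cmeas phi ->
  \int[rho]_(x in K) phi x =
  a * \int[mu]_(x in K) phi x + (1 - a) * \int[nu]_(x in K) phi x.
Proof.
move=> /andP[a0 a1] mix nphi.
have a'0 : 0 <= 1 - a by rewrite subr_ge0.
pose k1 := NngNum a0; pose k2 := NngNum a'0.
have I1 := integrable_cmeas mu nphi.
have I2 := integrable_cmeas nu nphi.
have mK := @K_measurable R.
have ge0case (psi : state R -> R) : cmeas psi -> (forall x, K x -> 0 <= psi x) ->
  \int[rho]_(x in K) psi x =
  a * \int[mu]_(x in K) psi x + (1 - a) * \int[nu]_(x in K) psi x.
  move=> npsi psi0; have mpsi : measurable_fun K (EFin \o psi).
    by apply/measurable_EFinP/measurable_funTS; case: npsi.
  rewrite /Rintegral.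
  rewrite (eq_measure_integral (measure_add (mscale k1 mu) (mscale k2 nu))); last first.
    by move=> A mA _; apply: (eq_trans (mix A mA)); rewrite [RHS]measure_addE.
  rewrite ge0_integral_measure_add//.
  rewrite !ge0_integral_mscale//=.
  rewrite fineD; [|rewrite fin_numM//; exact/integrable_fin_num/integrable_cmeas..].
  by rewrite !fineM//; exact/integrable_fin_num/integrable_cmeas.
have [B B0 phiB] := cmeas_bounded nphi.
have nB : cmeas (fun _ : state R => B) by exact: cmeas_cst.
have := ge0case _ (cmeasD nphi nB).
have := ge0case _ nB (fun x _ => B0).
rewrite !KintD// => -> H.
have phiB0 x : K x -> 0 <= phi x + B.
  by move=> /phiB; rewrite ler_norml => /andP[+ _]; rewrite -subr_ge0 opprK.
by move: (H phiB0); rewrite !mulrDr addrACA => /addIr.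
Qed.

End cmeas_theory.

(** * Uniqueness of the law of (p, q) *)

Lemma soft_step_bound (R : realType) (c : R) (n : nat) (x : R) :
  0 <= soft_step c n x <= 1.
Proof.
by rewrite /soft_step expR_ge0 expR_le1 oppr_le0 mulr_ge0// expR_ge0.
Qed.

Lemma cvg_soft_step (R : realType) (c x : R) :
  soft_step c n.+1 x @[n --> \oo] --> (\1_`]-oo, c[%classic x : R).
Proof.
rewrite indicE mem_setE in_itv /=; have [xc|cx] := ltP x c.
  have d0 : 0 < c - x by rewrite subr_gt0.
  apply: (@squeeze_cvgr _ _ _ _ (fun n => 1 - 2 / (c - x) ^+ 2 * harmonic n)
    (fun=> 1)); last exact: cvg_cst.
    near=> n; case/andP: (soft_step_bound c n.+1 x) => _ ->; rewrite andbT.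
    apply: le_trans (expR_ge1Dx _); rewrite lerD2l lerN2.
    have n0 : 0 < n.+1%:R :> R by rewrite ltr0n.
    have -> : n.+1%:R * (x - c) = - (n.+1%:R * (c - x)) by ring.
    rewrite expRN.
    have le1 : (n.+1%:R * (c - x)) ^+ 2 / 2 <= expR (n.+1%:R * (c - x)).
      have := @expR_ge1Dxn R (n.+1%:R * (c - x)) 1 (mulr_ge0 (ltW n0) (ltW d0)).
      by apply: le_trans; rewrite lerDr.
    have e0 := expR_gt0 (n.+1%:R * (c - x)).
    rewrite ler_pdivrMr// /harmonic /=.
    apply: le_trans (ler_wpM2l _ le1); last first.
      by rewrite mulr_ge0 ?invr_ge0// divr_ge0// exprn_ge0// ltW.
    rewrite le_eqVlt; apply/orP; left; apply/eqP; field.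
    by rewrite gt_eqF//= lt0r_neq0.
  have : 1 - 2 / (c - x) ^+ 2 * harmonic n @[n --> \oo] -->
      1 - 2 / (c - x) ^+ 2 * (0 : R).
    by apply: cvgB; [exact: cvg_cst|apply: cvgMr; exact: cvg_harmonic].
  by rewrite mulr0 subr0.
apply: (@squeeze_cvgr _ _ _ _ (fun=> 0) harmonic); last exact: cvg_harmonic.
  near=> n; case/andP: (soft_step_bound c n.+1 x) => -> _ /=.
  rewrite /soft_step /harmonic /= expRN lef_pV2 ?posrE ?expR_gt0//.
  have n0 : 0 <= n.+1%:R :> R by [].
  apply: (@le_trans _ _ (n.+1%:R * expR (n.+1%:R * (x - c)))).
    by rewrite ler_peMr// -[leLHS]expR0 ler_expR mulr_ge0// subr_ge0.
  by apply: le_trans (expR_ge1Dx _); rewrite lerDr.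
exact: cvg_cst.
Unshelve. all: by end_near. Qed.

Section measure_unique_ray.
Local Open Scope ereal_scope.

Lemma measure_unique_ray (R : realType) (m1 m2 : {measure set R -> \bar R}) :
  m1 setT < +oo -> (forall c : R, m1 `]-oo, c[%classic = m2 `]-oo, c[%classic) ->
  forall A, measurable A -> m1 A = m2 A.
Proof.
move=> m1oo m12 A mA.
apply: (measure_unique (@RGenInftyO.G R) (fun n => `]-oo, n%:R[%classic)) => //.
- exact: RGenInftyO.measurableE.
- move=> _ _ [x ->] [y ->]; exists (Num.min x y); apply/seteqP.
  by split => z /=; rewrite !in_itv /= lt_min => /andP.
- by move=> n; exists n%:R.
- apply/seteqP; split => // x _; exists (Num.truncn `|x|).+1 => //=.
  rewrite in_itv /=; apply: le_lt_trans (ler_norm _) _.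
  exact: truncnS_gt.
- by move=> _ [c ->].
- move=> n; apply: le_lt_trans m1oo.
  by rewrite le_measure ?inE.
Qed.

Lemma probability_unique_quadrant (R : realType) (m1 m2 : probability (R * R)%type R) :
  (forall a b : R, m1 (`]-oo, a[%classic `*` `]-oo, b[%classic) =
                   m2 (`]-oo, a[%classic `*` `]-oo, b[%classic)) ->
  forall A, measurable A -> m1 A = m2 A.
Proof.
move=> m12 X mX.
have fin (m : probability (R * R)%type R) (A : set (R * R)) :
    measurable A -> m A < +oo.
  by move=> mA; exact: le_lt_trans (probability_le1 m mA) (ltry 1).
have step1 (b : R) (A : set R) : measurable A ->
    m1 (A `*` `]-oo, b[%classic) = m2 (A `*` `]-oo, b[%classic).
  have mD : measurable (setT `*` `]-oo, b[%classic : set (R * R)) by exact: measurableX.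
  have E (m : probability (R * R)%type R) (B : set R) :
      pushforward (mrestr m mD) (fst : R * R -> R) B = m (B `*` `]-oo, b[%classic).
    rewrite /pushforward /mrestr; congr (m _).
    by apply/seteqP; split => -[x y] /=; [move=> [? []]|move=> []].
  move=> mA.
  pose pf (m : probability (R * R)%type R) : {measure set R -> \bar R} :=
    pushforward (mrestr m mD) (fst : R * R -> R).
  have Epf m B : pf measurable_fst m B = m (B `*` `]-oo, b[%classic) by exact: E.
  have := @measure_unique_ray _ (pf measurable_fst m1) (pf measurable_fst m2) _ _ A mA.
  rewrite !Epf; apply; first by apply: fin; exact: measurableX.
  by move=> c; rewrite [LHS]Epf [RHS]Epf.
have step2 (A B : set R) : measurable A -> measurable B ->
    m1 (A `*` B) = m2 (A `*` B).
  move=> mA; have mD : measurable (A `*` setT : set (R * R)) by exact: measurableX.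
  have E (m : probability (R * R)%type R) (C : set R) :
      pushforward (mrestr m mD) (snd : R * R -> R) C = m (A `*` C).
    rewrite /pushforward /mrestr; congr (m _).
    by apply/seteqP; split => -[x y] /=; [move=> [? []]|move=> []].
  move=> mB.
  pose pf (m : probability (R * R)%type R) : {measure set R -> \bar R} :=
    pushforward (mrestr m mD) (snd : R * R -> R).
  have Epf m C : pf measurable_snd m C = m (A `*` C) by exact: E.
  have := @measure_unique_ray _ (pf measurable_snd m1) (pf measurable_snd m2) _ _ B mB.
  rewrite !Epf; apply; first by apply: fin; exact: measurableX.
  by move=> c; rewrite [LHS]Epf [RHS]Epf; exact: step1.
pose C : set (set (R * R)) :=
  [set A `*` B | A in measurable & B in measurable].
apply: (measure_unique C (fun=> setT)) => //.
- exact: measurable_prod_measurableType.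
- move=> _ _ [A1 mA1 [B1 mB1 <-]] [A2 mA2 [B2 mB2 <-]].
  rewrite -setXI; exists (A1 `&` A2); first exact: measurableI.
  by exists (B1 `&` B2) => //; exact: measurableI.
- by move=> _; exists setT => //; exists setT => //; rewrite setXTT.
- exact: bigcup_const.
- by move=> _ [A mA [B mB <-]]; exact: step2.
- by move=> _; exact: fin.
Qed.

End measure_unique_ray.

Lemma Kint_soft_step_cvg (R : realType) (mu : probability (state R) R) (a b : R) :
  supported_in mu K ->
  (\int[mu]_(x in K) tensor (fun=> 1) (soft_step a n.+1) (soft_step b n.+1) x)
    @[n --> \oo] --> fine (marginal_pq mu (`]-oo, a[%classic `*` `]-oo, b[%classic)).
Proof.
move=> sK.
pose Q : set (state R) := setT `*` (`]-oo, a[%classic `*` `]-oo, b[%classic).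
have mQ : measurable Q by apply: measurableX => //; exact: measurableX.
have mK := @K_measurable R.
have cs c n : continuous (soft_step c n : R -> R).
  exact/smooth1_continuous/smooth1_soft_step.
have ct n : cmeas (tensor (fun=> 1) (soft_step a n) (soft_step b n)).
  by apply: cmeas_tensor => //; move=> x; exact: cst_continuous.
have -> : marginal_pq mu (`]-oo, a[%classic `*` `]-oo, b[%classic) =
    (\int[mu]_(x in K) (\1_Q x)%:E)%E.
  rewrite integral_indic//.
  have -> : marginal_pq mu (`]-oo, a[%classic `*` `]-oo, b[%classic) = mu Q.
    by rewrite /= /distribution /pushforward; congr (mu _);
       apply/seteqP; split => -[x y] //= [].
  apply/eqP; rewrite eq_le; apply/andP; split; last first.
    by apply: le_measure; rewrite ?inE//; exact: measurableI.
  rewrite -[leRHS]adde0 -[in leRHS]sK.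
  apply: le_trans (measureU2 _ _ _); rewrite ?inE//.
  - apply: le_measure; rewrite ?inE//.
      by apply: measurableU; [exact: measurableI|exact: measurableC].
    by move=> x Qx; have [Kx|nKx] := pselect (K x); [left|right].
  - exact: measurableI.
  - exact: measurableC.
have [] := @dominated_convergence _ _ _ mu K mK
  (fun n x => (tensor (fun=> 1) (soft_step a n.+1) (soft_step b n.+1) x)%:E)
  (fun x => (\1_Q x)%:E) (fun=> 1%E).
- by move=> n; apply/measurable_EFinP/measurable_funTS; case: (ct n.+1).
- by apply/measurable_EFinP.
- apply: aeW => -[w [p q]] _; apply: cvg_EFin; first by near=> n.
  have -> : \1_Q (w, (p, q)) =
      1 * \1_`]-oo, a[%classic p * \1_`]-oo, b[%classic q :> R.
    rewrite mul1r !indicE -natrM mulnb; congr (_%:R); congr nat_of_bool.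
    apply/idP/andP; rewrite !inE /Q /=; tauto.
  by apply: cvgM; first apply: cvgM; [exact: cvg_cst|exact: cvg_soft_step..].
- exact: (integrable_cmeas mu (cmeas_cst 1)).
- apply: aeW => -[w [p q]] n _; rewrite lee_fin /tensor /= mul1r.
  case/andP: (soft_step_bound a n.+1 p) => a0 a1.
  case/andP: (soft_step_bound b n.+1 q) => b0 b1.
  by rewrite ger0_norm ?mulr_ge0// mulr_ile1.
move=> iQ _ cv; apply: fine_cvg; rewrite fineK//.
exact: integrable_fin_num.
Unshelve. all: by end_near. Qed.

Lemma marginal_pq_unique (R : realType) (mu nu : probability (state R) R) :
  supported_in mu K -> supported_in nu K ->
  (forall b d : R -> R, smooth1 b -> smooth1 d ->
    \int[mu]_(x in K) tensor (fun=> 1) b d x =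
    \int[nu]_(x in K) tensor (fun=> 1) b d x) ->
  forall A, measurable A -> marginal_pq mu A = marginal_pq nu A.
Proof.
move=> smu snu munu; apply: probability_unique_quadrant => a b.
have fin (m : probability (state R) R) :
    marginal_pq m (`]-oo, a[ `*` `]-oo, b[) \is a fin_num.
  by apply: fin_num_measure; exact: measurableX.
rewrite -[LHS]fineK// -[RHS]fineK//; congr (_%:E).
have := Kint_soft_step_cvg (a := a) (b := b) smu.
under eq_fun do rewrite (munu _ _ (smooth1_soft_step a _) (smooth1_soft_step b _)).
move=> /(cvg_lim (@Rhausdorff R)) <-; apply: cvg_lim => //; exact: Kint_soft_step_cvg.
Qed.

(** * Weak solutions *)

Lemma smooth1_cst (R : realType) (c : R) : smooth1 (fun=> c).
Proof.
rewrite (_ : (fun=> c) = horner c%:P); first exact: smooth1_horner.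
by apply/funext => x; rewrite hornerC.
Qed.

Lemma smooth1_subX (R : realType) (c : R) (n : nat) :
  smooth1 (fun x => (x - c) ^+ n).
Proof.
rewrite (_ : (fun x => _) = horner (('X - c%:P) ^+ n)); first exact: smooth1_horner.
by apply/funext => x; rewrite horner_exp hornerXsubC.
Qed.

Lemma smooth1_X (R : realType) (n : nat) : smooth1 (fun x : R => x ^+ n).
Proof.
rewrite (_ : (fun x => _) = horner 'X^n); first exact: smooth1_horner.
by apply/funext => x; rewrite hornerXn.
Qed.

Lemma smooth1_id (R : realType) : smooth1 (fun x : R => x).
Proof. by have := smooth1_X R 1; under eq_fun do rewrite expr1. Qed.

Lemma is_derive_subX (R : realType) (c x : R) (n : nat) :
  is_derive x 1 (fun y => (y - c) ^+ n.+1) (n.+1%:R * (x - c) ^+ n).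
Proof.
have -> : (fun y => (y - c) ^+ n.+1) = horner (('X - c%:P) ^+ n.+1).
  by apply/funext => y; rewrite horner_exp hornerXsubC.
apply: is_derive_eq; rewrite deriv_exp derivB derivX derivC subr0 mul1r.
by rewrite hornerMn horner_exp hornerXsubC mulr_natl.
Qed.

Lemma cmeas_tensor_smooth (R : realType) (a b d : R -> R) :
  smooth1 a -> smooth1 b -> smooth1 d -> cmeas (tensor a b d).
Proof. by move=> *; apply: cmeas_tensor; exact: smooth1_continuous. Qed.

Lemma weak_curve_continuous (R : realType) (g : R -> probability (state R) R)
    (phi : state R -> R) : weak_curve g -> cmeas phi ->
  {within `[0, +oo[, continuous (fun t : R => \int[g t]_(x in K) phi x)}.
Proof. by move=> [_ cg] [cphi _]; apply: cg; exact: continuous_subspaceT. Qed.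

Section weak_solution_theory.
Context {R : realType}.
Variables (c : R) (m : R -> R) (g0 : probability (state R) R)
  (g : R -> probability (state R) R).
Hypothesis wsol : weak_solution c m g0 g.

Lemma weak_solution_supported t : 0 <= t -> supported_in (g t) K.
Proof. by case: wsol => -[+ _ _]; exact. Qed.

Lemma weak_solution_init (phi : state R -> R) : smooth phi ->
  \int[g 0]_(x in K) phi x = \int[g0]_(x in K) phi x.
Proof.
move=> sphi; case: wsol => _ /(_ phi 0 sphi (lexx _)) ->.
by rewrite set_itv1 Rintegral_set1 addr0.
Qed.

Lemma weak_solution_pq (b d : R -> R) (t : R) : smooth1 b -> smooth1 d -> 0 <= t ->
  \int[g t]_(x in K) tensor (fun=> 1) b d x =
  \int[g0]_(x in K) tensor (fun=> 1) b d x.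
Proof.
move=> sb sd t0.
have s1 := smooth1_cst (1 : R).
case: wsol => _ /(_ _ t (smooth_tensor s1 sb sd) t0) ->.
have D1 (x : R) : is_derive x 1 (fun=> 1 : R) (0 : R) by exact: is_derive_cst.
have E s : \int[g s]_(x in K) ((m s - x.1) * c * x.2.2 *
    D_w (tensor (fun=> 1) b d) x) = 0.
  rewrite (D_w_tensor b d (a' := fun=> 0) D1).
  rewrite (@eq_Rintegral _ _ _ _ _ (fun=> 0)).
    by rewrite Rintegral_cst ?mul0r//; exact: K_measurable.
  by move=> x _; rewrite /tensor !mul0r mulr0.
rewrite [X in _ + X](@eq_Rintegral _ _ _ _ _ (fun=> 0)) => [|s _]; last exact: E.
by rewrite Rintegral_cst// mul0r addr0.
Qed.

Lemma weak_solution_mean_p t : 0 <= t -> mean_p (g t) = mean_p g0.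
Proof.
move=> t0.
have E : (fun x : state R => x.2.1) = tensor (fun=> 1) (fun p => p) (fun=> 1).
  by apply/funext => x; rewrite /tensor mul1r mulr1.
rewrite /mean_p E; apply: weak_solution_pq => //; first exact: smooth1_id.
exact: smooth1_cst.
Qed.

Lemma weak_solution_derive (a a' b d : R -> R) :
  {within `[0, +oo[, continuous m} ->
  smooth1 a -> smooth1 b -> smooth1 d ->
  continuous a' -> (forall x : R, is_derive x 1 a (a' x)) ->
  forall t : R, 0 < t ->
  is_derive t 1 (fun t => \int[g t]_(x in K) tensor a b d x)
    (c * (m t * \int[g t]_(x in K) (x.2.2 * tensor a' b d x) -
          \int[g t]_(x in K) (x.1 * (x.2.2 * tensor a' b d x)))).
Proof.
move=> cm sa sb sd ca' Da.
have n1 : cmeas (fun x : state R => x.2.2 * tensor a' b d x).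
  apply: (cmeasM (@cmeas_q R)).
  by apply: cmeas_tensor => //; exact: smooth1_continuous.
have n2 : cmeas (fun x : state R => x.1 * (x.2.2 * tensor a' b d x)).
  exact: cmeasM (@cmeas_w R) n1.
have E s : \int[g s]_(x in K) ((m s - x.1) * c * x.2.2 * D_w (tensor a b d) x) =
   c * (m s * \int[g s]_(x in K) (x.2.2 * tensor a' b d x) -
          \int[g s]_(x in K) (x.1 * (x.2.2 * tensor a' b d x))).
  rewrite (D_w_tensor b d Da) -KintZ// -KintB//; last first.
    by apply: cmeasM n1; exact: cmeas_cst.
  rewrite -KintZ//; last first.
    by apply: cmeasB n2; apply: cmeasM n1; exact: cmeas_cst.
  by apply: eq_Rintegral => x _; ring.
apply: is_derive_Rintegral_halfline; last first.
  move=> t t0; case: wsol => _ /(_ _ t (smooth_tensor sa sb sd) t0) ->.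
  by congr (_ + _); apply: eq_Rintegral => s _; exact: E.
case: wsol => wc _.
have c1 := weak_curve_continuous wc n1.
have c2 := weak_curve_continuous wc n2.
move=> x; apply: cvgM; first exact: cst_continuous.
apply: cvgB; last exact: c2.
by apply: cvgM; [exact: cm|exact: c1].
Qed.

End weak_solution_theory.

(** * Decomposition into stubborn and non-stubborn parts *)

Lemma pow2_decay_eq0 (R : realType) (x B : R) :
  (forall n, `|x| <= B / 2 ^+ n) -> x = 0.
Proof.
move=> H; apply/eqP; rewrite -normr_eq0; apply/negPn/negP => x0.
have xp : 0 < `|x| by rewrite lt0r x0 normr_ge0.
pose n := (Num.truncn (B / `|x|)).+1.
have Bn : B / `|x| < 2 ^+ n.
  apply: lt_trans (truncnS_gt _) _.
  by rewrite -natrX ltr_nat ltn_expl.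
have := H n; apply/negP; rewrite -ltNge ltr_pdivrMr ?exprn_gt0//.
by move: Bn; rewrite ltr_pdivrMr// mulrC.
Qed.

Section stubborn_decomposition.
Context {R : realType}.
Variables (alpha c : R) (m : R -> R) (f00 f01 f0 : probability (state R) R)
  (f f1 : R -> probability (state R) R).
Hypotheses (alpha01 : 0 <= alpha <= 1) (c0 : 0 < c)
  (s00 : supported_in f00 K) (s00q : supported_in f00 [set x | x.2.2 = 0])
  (mix : mixture alpha f00 f01 f0)
  (cm : {within `[0, +oo[, continuous m})
  (fsol : weak_solution c m f0 f) (f1sol : weak_solution c m f01 f1).

Let T k := tensor (fun w : R => w) (fun p => p) (fun q => q ^+ k).
Let H k t := \int[f t]_(x in K) T k x - alpha * \int[f00]_(x in K) T k x
  - (1 - alpha) * \int[f1 t]_(x in K) T k x.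

Let sT k : smooth (T k).
Proof. apply: smooth_tensor; [exact: smooth1_id..|exact: smooth1_X]. Qed.

Let cT k : cmeas (T k).
Proof. apply: cmeas_tensor_smooth; [exact: smooth1_id..|exact: smooth1_X]. Qed.

Let mq0 : measurable ([set x | x.2.2 = 0] : set (state R)).
Proof.
have [_ /(_ measurableT [set 0] (measurable_set1 0))] := @cmeas_q R.
by rewrite setTI.
Qed.

Let Kint_q0 (phi : state R -> R) : cmeas phi ->
  (forall x, x.2.2 = 0 -> phi x = 0) -> \int[f00]_(x in K) phi x = 0.
Proof.
move=> cphi phi0; have c0' := cmeas_cst (0 : R).
have I0 : \int[f00]_(x in K) (0 : R) = 0.
  by rewrite Rintegral_cst ?mul0r//; exact: K_measurable.
apply: le_anti; rewrite -{}I0; apply/andP; split;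
  by apply: (le_Kint_supp mq0 s00q) => // x _ /phi0 ->.
Qed.

Let T_le1 k x : K x -> `|T k x| <= 1.
Proof.
case: x => w [p q] [/= w1 [/andP[p0 p1] /andP[q0 q1]]].
rewrite /T /tensor /= !normrM (ger0_norm p0) (ger0_norm (exprn_ge0 _ q0)).
rewrite mulr_ile1 ?mulr_ge0 ?exprn_ge0 ?exprn_ile1//.
by rewrite mulr_ile1// ler_norml.
Qed.

Let H_le3 k t : 0 <= t -> `|H k t| <= 3.
Proof.
move=> t0; case/andP: alpha01 => a0 a1.
have ge0 : 0 <= 1 - alpha by rewrite subr_ge0.
have N1 := norm_Kint_le (weak_solution_supported fsol t0) (cT k) (@T_le1 k).
have N2 := norm_Kint_le (weak_solution_supported f1sol t0) (cT k) (@T_le1 k).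
have N3 := norm_Kint_le s00 (cT k) (@T_le1 k).
rewrite /H -[3](_ : 1 + 1 + 1 = _); last by ring.
apply: le_trans (ler_normB _ _) (lerD _ _).
  apply: le_trans (ler_normB _ _) (lerD N1 _).
  by rewrite normrM mulr_ile1// ger0_norm.
by rewrite normrM mulr_ile1// ger0_norm// gerBl.
Qed.

Let H0 k : H k 0 = 0.
Proof.
rewrite /H (weak_solution_init fsol)// (weak_solution_init f1sol)//.
by rewrite (Kint_mixture alpha01 mix)//; ring.
Qed.

Let H_continuous k : {within `[0, +oo[, continuous (H k)}.
Proof.
have c1 := weak_curve_continuous (proj1 fsol) (cT k).
have c2 := weak_curve_continuous (proj1 f1sol) (cT k).
move=> x; apply: cvgB.
  by apply: cvgB; [exact: c1|exact: cvg_cst].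
by apply: cvgM; [exact: cvg_cst|exact: c2].
Qed.

Let H_derive k (t : R) : 0 < t -> is_derive t 1 (H k) (- c * H k.+1 t).
Proof.
move=> t0; have t0' := ltW t0.
have i1 : continuous ((fun=> 1) : R -> R) by move=> x; exact: cst_continuous.
have Did (x : R) : is_derive x 1 (fun x : R => x) 1 by exact: is_derive_id.
have sid := @smooth1_id R.
have D1 := weak_solution_derive fsol cm sid sid (@smooth1_X R k) i1 Did t0.
have D2 := weak_solution_derive f1sol cm sid sid (@smooth1_X R k) i1 Did t0.
pose P := tensor (fun=> 1 : R) (fun p => p) (fun q => q ^+ k.+1).
have cP : cmeas P.
  by apply: cmeas_tensor_smooth => //; [exact: smooth1_cst|exact: smooth1_X].
have EP : (fun x : state R => x.2.2 *
    tensor (fun=> 1) (fun p => p) (fun q => q ^+ k) x) = P.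
  by apply/funext => x; rewrite /P /tensor exprS; ring.
have ET : (fun x : state R => x.1 * (x.2.2 *
    tensor (fun=> 1) (fun p => p) (fun q => q ^+ k) x)) = T k.+1.
  by apply/funext => x; rewrite /T /tensor exprS; ring.
have P0 : \int[f00]_(x in K) P x = 0.
  by apply: Kint_q0 => // x x0; rewrite /P /tensor x0 exprS mul0r mulr0.
have T0 : \int[f00]_(x in K) T k.+1 x = 0.
  by apply: Kint_q0 => // x x0; rewrite /T /tensor x0 exprS mul0r mulr0.
have consP : \int[f t]_(x in K) P x = (1 - alpha) * \int[f1 t]_(x in K) P x.
  rewrite /P (weak_solution_pq fsol)//; last exact: smooth1_X.
  rewrite (weak_solution_pq f1sol)//; last exact: smooth1_X.
  by rewrite (Kint_mixture alpha01 mix)// -/P P0 mulr0 add0r.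
move: D1 D2; rewrite EP ET => D1 D2.
have D3 : is_derive t 1 (fun=> alpha * \int[f00]_(x in K) T k x) (0 : R).
  exact: is_derive_cst.
have := is_deriveB (is_deriveB D1 D3) (is_deriveZ (1 - alpha) D2).
move=> D; apply: (is_derive_eq D).
by rewrite /H T0 consP /GRing.scale /=; ring.
Qed.

Let H_decay n k t : 0 <= t -> `|H k t| <= 3 * expR (2 * c * t) / 2 ^+ n.
Proof.
elim: n k t => [|n IH] k t t0.
  rewrite expr0 divr1 (le_trans (H_le3 k t0))// ler_peMr//.
  by rewrite -[leLHS]expR0 ler_expR mulr_ge0// mulr_ge0// ltW.
pose M (s : R) := 3 / 2 ^+ n.+1 * expR (2 * c * s).
have DM (s : R) : is_derive s 1 M (c * (3 * expR (2 * c * s) / 2 ^+ n)).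
  have -> : M = (3 / 2 ^+ n.+1) *: (expR \o ((2 * c) *: @idfun R)) by [].
  apply: is_derive_eq; rewrite /GRing.scale /= mulr1 exprS.
  by field; rewrite expf_neq0.
have cM : continuous M.
  by move=> x; apply/differentiable_continuous/derivable1_diffP; case: (DM x).
have M0 : 0 <= M 0 by rewrite mulr_ge0 ?expR_ge0.
have cM' : {within `[0, +oo[, continuous M} by exact: continuous_subspaceT.
rewrite (_ : 3 * _ / _ = M t); last by rewrite /M; ring.
have ge0u s : 0 < s -> 0 <= c * (3 * expR (2 * c * s) / 2 ^+ n) + - c * H k.+1 s.
  move=> s0; rewrite mulNr -mulrBr mulr_ge0 ?(ltW c0)// subr_ge0.
  exact: le_trans (ler_norm _) (IH _ _ (ltW s0)).
have ge0d s : 0 < s -> 0 <= c * (3 * expR (2 * c * s) / 2 ^+ n) - - c * H k.+1 s.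
  move=> s0; rewrite mulNr opprK -mulrDr mulr_ge0 ?(ltW c0)//.
  rewrite -lerBlDl sub0r; have := IH k.+1 s (ltW s0).
  by rewrite ler_norml => /andP[+ _]; rewrite lerNl.
have cu : {within `[0, +oo[, continuous (fun s => M s + H k s)}.
  by move=> x; apply: cvgD; [exact: cM'|exact: H_continuous].
have cd : {within `[0, +oo[, continuous (fun s => M s - H k s)}.
  by move=> x; apply: cvgB; [exact: cM'|exact: H_continuous].
have du (s : R) : 0 < s -> is_derive s 1 (fun s => M s + H k s)
    (c * (3 * expR (2 * c * s) / 2 ^+ n) + - c * H k.+1 s).
  by move=> s0; exact: is_deriveD (DM s) (H_derive k s0).
have dd (s : R) : 0 < s -> is_derive s 1 (fun s => M s - H k s)
    (c * (3 * expR (2 * c * s) / 2 ^+ n) - - c * H k.+1 s).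
  by move=> s0; exact: is_deriveB (DM s) (H_derive k s0).
have up := halfline_nondecreasing cu du ge0u t0.
have dn := halfline_nondecreasing cd dd ge0d t0.
move: up dn; rewrite H0 addr0 subr0 => up dn.
rewrite ler_norml lerNl -subr_ge0 opprK (le_trans M0 up) /=.
by rewrite -subr_ge0 (le_trans M0 dn).
Qed.

Lemma momentum_decomposition t : 0 <= t ->
  \int[f t]_(x in K) (x.2.1 * x.1) =
  alpha * \int[f00]_(x in K) (x.2.1 * x.1) +
  (1 - alpha) * \int[f1 t]_(x in K) (x.2.1 * x.1).
Proof.
move=> t0; have := pow2_decay_eq0 (fun n => H_decay n 0 t0).
have -> : (fun x : state R => x.2.1 * x.1) = T 0%N.
  by apply/funext => x; rewrite /T /tensor expr0 mulr1 mulrC.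
by rewrite /H => /eqP; rewrite subr_eq0 subr_eq addrC => /eqP.
Qed.

End stubborn_decomposition.

(** * Coupling with a Dirac mass *)

Section graph_coupling.
Context {R : realType}.

Definition project_to (w : R) : state R -> (state R * state R)%type :=
  fun x => (x, (w, x.2)).

Lemma measurable_project_to (w : R) : measurable_fun setT (project_to w).
Proof.
apply/measurable_fun_pair => //; apply/measurable_fun_pair => //.
Qed.

Lemma measurable_dist3 :
  measurable_fun setT (fun z : (state R * state R)%type => dist3 z.1 z.2).
Proof.
have m1 : measurable_fun setT (fun z : (state R * state R)%type => z.1).
  exact: measurable_fst.
have m2 : measurable_fun setT (fun z : (state R * state R)%type => z.2).
  exact: measurable_snd.
have mB (phi : state R -> R) : cmeas phi ->
    measurable_fun setT (fun z : (state R * state R)%type => (phi z.1 - phi z.2) ^+ 2).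
  move=> [_ mphi]; apply: measurable_funX; apply: measurable_funB.
    exact: (measurableT_comp mphi m1).
  exact: (measurableT_comp mphi m2).
apply: (measurableT_comp (continuous_measurable_fun (@sqrt_continuous R))).
apply: measurable_funD; first apply: measurable_funD.
- exact: mB (@cmeas_w R).
- exact: mB (@cmeas_p R).
- exact: mB (@cmeas_q R).
Qed.

Lemma dist3_project_to (w : R) (x : state R) : dist3 x (w, x.2) = `|x.1 - w|.
Proof. by rewrite /dist3 /= !subrr expr0n /= !addr0 sqrtr_sqr. Qed.

HB.instance Definition _ (w : R) :=
  isMeasurableFun.Build _ _ _ _ (project_to w) (measurable_project_to w).

Lemma W1_dirac_prod_le (mu nu : probability (state R) R) (w : R) :
  supported_in mu K ->
  (forall A, measurable A -> marginal_pq mu A = marginal_pq nu A) ->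
  (W1 dist3 mu (dirac w \x marginal_pq nu) <=
   (\int[mu]_(x in K) `|x.1 - w|)%:E)%E.
Proof.
move=> sK munu.
have mK := @K_measurable R.
have cd : cmeas (fun x : state R => `|x.1 - w|).
  by apply: cmeas_norm; apply: cmeasB (@cmeas_w R) (cmeas_cst w).
have intd : mu.-integrable K (EFin \o (fun x : state R => `|x.1 - w|)).
  exact: integrable_cmeas.
pose a : probability (state R * state R)%type R :=
  distribution mu (project_to w : {mfun state R >-> (state R * state R)%type}).
apply: (@le_trans _ _ (\int[a]_z (dist3 z.1 z.2)%:E)%E).
  apply: ereal_inf_lbound; exists a => // A mA; split; first by [].
  rewrite /product_measure1 integral_dirac//=; last exact: measurable_fun_xsection.
  rewrite diracT mul1e -munu; last exact: measurable_xsection.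
  by rewrite /marginal_pq /distribution /= /pushforward; congr (mu _);
     apply/seteqP; split => x; rewrite /= /xsection /= inE.
rewrite /Rintegral fineK; last exact: integrable_fin_num.
rewrite ge0_integral_distribution; last 2 first.
- by apply/measurable_EFinP; exact: measurable_dist3.
- by move=> z; rewrite lee_fin sqrtr_ge0.
rewrite (ge0_negligible_integral (measurableC mK) measurableT _ _ sK).
- rewrite setDE setCK setTI le_eqVlt; apply/orP; left; apply/eqP.
  by apply: eq_integral => x _ /=; rewrite dist3_project_to.
- apply: measurableT_comp; last exact: measurable_project_to.
  by apply/measurable_EFinP; exact: measurable_dist3.
- by move=> x _ /=; rewrite lee_fin sqrtr_ge0.
Qed.

End graph_coupling.

(** * Moment decay *)

Lemma young_pow (R : realDomainType) (n : nat) (x y : R) : 0 <= x -> 0 <= y ->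
  n.+1%:R * x * y ^+ n <= x ^+ n.+1 + n%:R * y ^+ n.+1.
Proof.
move=> x0 y0; elim: n => [|n IH];
  first by rewrite expr0 expr1 mul0r addr0 mul1r mulr1.
have h1 := ler_wpM2l x0 IH.
have h2 : 0 <= n.+1%:R * ((x - y) ^+ 2 * y ^+ n).
  by rewrite mulr_ge0// mulr_ge0 ?sqr_ge0 ?exprn_ge0.
rewrite -subr_ge0; rewrite -subr_ge0 in h1.
have := addr_ge0 h1 h2; congr (0 <= _).
by rewrite -!natr1 !exprS; ring.
Qed.

Lemma young_pow_odd (R : realDomainType) (n : nat) (x y : R) : odd n ->
  n.+1%:R * x * y ^+ n <= x ^+ n.+1 + n%:R * y ^+ n.+1.
Proof.
move=> on; have ev (z : R) : z ^+ n.+1 = `|z| ^+ n.+1.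
  by rewrite -normrX ger0_norm// exprn_even_ge0//= on.
rewrite (ev x) (ev y); apply: le_trans (young_pow n (normr_ge0 x) (normr_ge0 y)).
apply: le_trans (ler_norm _) _.
by rewrite !normrM normrX normr_nat.
Qed.

Section moment_decay.
Context {R : realType}.
Variables (alpha eps P0 P1 c w0 : R) (m : R -> R) (f01 : probability (state R) R)
  (f1 : R -> probability (state R) R).
Hypotheses (alpha01 : 0 <= alpha <= 1) (P00 : 0 <= P0) (w01 : `|w0| <= 1)
  (P1E : P1 = mean_p f01) (cE : c = alpha * P0 + (1 - alpha) * P1)
  (cm : {within `[0, +oo[, continuous m})
  (f1sol : weak_solution c m f01 f1)
  (f1q : forall t, 0 <= t -> supported_in (f1 t) [set x | eps <= x.2.2])
  (mE : forall t, 0 <= t ->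
    c * (m t - w0) = (1 - alpha) * \int[f1 t]_(x in K) (x.2.1 * (x.1 - w0))).

Let P1_ge0 : 0 <= P1.
Proof. by rewrite P1E; apply: Rintegral_ge0 => -[w [p q]] [_ [/andP[]]]. Qed.

Let cu : cmeas (fun x : state R => x.1 - w0).
Proof. by apply: cmeasB (@cmeas_w R) (cmeas_cst w0). Qed.

Let moment n t := \int[f1 t]_(x in K) (x.1 - w0) ^+ n.

Let moment_tensor n : (fun t => \int[f1 t]_(x in K) (x.1 - w0) ^+ n) =
  (fun t => \int[f1 t]_(x in K)
     tensor (fun w => (w - w0) ^+ n) (fun=> 1) (fun=> 1) x).
Proof.
by apply/funext => t; apply: eq_Rintegral => x _; rewrite /tensor !mulr1.
Qed.

Let flux n t := \int[f1 t]_(x in K)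
  (c * (m t - x.1) * x.2.2 * (n.+1%:R * (x.1 - w0) ^+ n)).

Let moment_derive n (t : R) : 0 < t -> is_derive t 1 (moment n.+1) (flux n t).
Proof.
move=> t0; have s1 := smooth1_cst (1 : R).
have ca' : continuous (fun x : R => n.+1%:R * (x - w0) ^+ n).
  move=> x; apply: cvgM; first exact: cvg_cst.
  exact: (smooth1_continuous (smooth1_subX w0 n)).
have := weak_solution_derive f1sol cm (smooth1_subX w0 n.+1) s1 s1 ca'
  (fun x => is_derive_subX w0 x n) t0.
rewrite /moment moment_tensor => D; apply: (is_derive_eq D).
have n1 : cmeas (fun x : state R => x.2.2 *
    tensor (fun w => n.+1%:R * (w - w0) ^+ n) (fun=> 1) (fun=> 1) x).
  apply: (cmeasM (@cmeas_q R)); apply: cmeas_tensor => //; exact: smooth1_continuous.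
have n2 := cmeasM (@cmeas_w R) n1.
rewrite -KintZ// -KintB//; last by apply: cmeasM n1; exact: cmeas_cst.
rewrite -KintZ//; last by apply: cmeasB n2; apply: cmeasM n1; exact: cmeas_cst.
by apply: eq_Rintegral => x _; rewrite /tensor; ring.
Qed.

Let lambda := alpha * eps * P0.

Let flux_le n t : odd n -> 0 <= t ->
  flux n t <= (1 - n.+1%:R * lambda) * moment n.+1 t.
Proof.
move=> on t0; case/andP: alpha01 => a0 a1.
have a'0 : 0 <= 1 - alpha by rewrite subr_ge0.
set M := moment n.+1 t.
have pow_ge0 (z : R) : 0 <= z ^+ n.+1 by rewrite exprn_even_ge0//= on.
have cpow : cmeas (fun x : state R => (x.1 - w0) ^+ n.+1) by exact: cmeasX.
have cp := @cmeas_p R.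
have M0 : 0 <= M by apply: Rintegral_ge0 => x _.
have sK := weak_solution_supported f1sol t0.
have P1t : \int[f1 t]_(x in K) x.2.1 = P1.
  by rewrite P1E -(weak_solution_mean_p f1sol t0).
set J := \int[f1 t]_(x in K) (x.2.1 * (x.1 - w0)).
have cJ : cmeas (fun x : state R => x.2.1 * (x.1 - w0)) by exact: cmeasM.
have youngJ (y : R) : n.+1%:R * J * y ^+ n <= M + n%:R * P1 * y ^+ n.+1.
  pose k1 := n.+1%:R * y ^+ n; pose k2 := n%:R * y ^+ n.+1.
  have -> : n.+1%:R * J * y ^+ n = \int[f1 t]_(x in K) (k1 * (x.2.1 * (x.1 - w0))).
    by rewrite KintZ// /k1 mulrAC.
  have -> : M + n%:R * P1 * y ^+ n.+1 =
      \int[f1 t]_(x in K) ((x.1 - w0) ^+ n.+1 + k2 * x.2.1).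
    rewrite KintD//; last by apply: cmeasM cp; exact: cmeas_cst.
    by rewrite KintZ// P1t /k2 mulrAC.
  apply: le_Kint.
  - by apply: cmeasM cJ; exact: cmeas_cst.
  - by apply: cmeasD cpow _; apply: cmeasM cp; exact: cmeas_cst.
  - move=> [w [p q]] [_ [/andP[/= p0 p1] _]].
    have := ler_wpM2l p0 (young_pow_odd (w - w0) y on).
    have -> : p * (n.+1%:R * (w - w0) * y ^+ n) = k1 * (p * (w - w0)).
      by rewrite /k1; ring.
    move=> /le_trans; apply; rewrite mulrDr lerD ?ler_piMl//.
    by rewrite /k2 mulrC.
have cq := @cmeas_q R.
have mqe : measurable [set x : state R | eps <= x.2.2].
  have := cq.2 measurableT _ (measurable_itv `[eps, +oo[); rewrite setTI.
  by congr (measurable _); apply/seteqP; split => x /=; rewrite in_itv /= andbT.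
have -> : (1 - n.+1%:R * lambda) * M =
    \int[f1 t]_(x in K) (M - n.+1%:R * lambda * (x.1 - w0) ^+ n.+1).
  rewrite KintB ?KintZ ?Kint_cst//; [by rewrite mulrBl mul1r|exact: cmeas_cst|].
  by apply: cmeasM cpow; exact: cmeas_cst.
apply: (le_Kint_supp mqe (f1q t0)).
- apply: cmeasM; last by apply: cmeasM (cmeas_cst _) (cmeasX _ cu).
  apply: cmeasM cq; apply: cmeasM (cmeas_cst _) _.
  by apply: cmeasB (cmeas_cst _) (@cmeas_w R).
- by apply: cmeasB (cmeas_cst _) _; apply: cmeasM (cmeas_cst _) cpow.
move=> [w [p q]] [_ [_ /andP[/= q0 q1]]] /= qe.
set y := w - w0.
have -> : c * (m t - w) * q * (n.+1%:R * y ^+ n) =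
    q * ((1 - alpha) * (n.+1%:R * J * y ^+ n) - n.+1%:R * c * y ^+ n.+1).
  have -> : c * (m t - w) = c * (m t - w0) - c * y by rewrite /y; ring.
  by rewrite mE// -/J exprS; ring.
have Y0 := pow_ge0 y; set Y := y ^+ n.+1 in Y0 *.
have h1 := ler_wpM2l a'0 (youngJ y); rewrite -/Y in h1.
apply: (@le_trans _ _ (q * ((1 - alpha) * (M + n%:R * P1 * Y) - n.+1%:R * c * Y))).
  by rewrite ler_wpM2l// lerB.
have -> : q * ((1 - alpha) * (M + n%:R * P1 * Y) - n.+1%:R * c * Y) =
    q * (1 - alpha) * M - q * ((1 - alpha) * P1 * Y) - n.+1%:R * (alpha * P0 * Y * q).
  by rewrite cE -natr1; ring.
apply: lerB; last first.
  rewrite -mulrA ler_wpM2l//.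
  have -> : lambda * Y = alpha * P0 * Y * eps by rewrite /lambda; ring.
  by rewrite ler_wpM2l// mulr_ge0// mulr_ge0.
apply: (@le_trans _ _ (q * (1 - alpha) * M)).
  by rewrite gerBl mulr_ge0// mulr_ge0// mulr_ge0.
by rewrite ler_piMl// mulr_ile1// gerBl.
Qed.

Let moment_le n t : odd n -> 0 <= t ->
  moment n.+1 t <= 2 ^+ n.+1 * expR ((1 - n.+1%:R * lambda) * t).
Proof.
move=> on t0; set k := 1 - n.+1%:R * lambda.
have De (s : R) : is_derive s 1 (fun s : R => expR (- k * s)) (- k * expR (- k * s)).
  have -> : (fun s : R => expR (- k * s)) = expR \o (- k *: @idfun R) by [].
  by apply: is_derive_eq; rewrite /GRing.scale /= mulr1 mulrC.
have ce : continuous (fun s : R => expR (- k * s)).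
  by move=> x; apply/differentiable_continuous/derivable1_diffP; case: (De x).
have cpow : cmeas (fun x : state R => (x.1 - w0) ^+ n.+1) by exact: cmeasX.
have cG : {within `[0, +oo[,
    continuous (fun s => - (moment n.+1 s * expR (- k * s)))}.
  move=> x; apply: cvgN; apply: cvgM.
    exact: (weak_curve_continuous (proj1 f1sol) cpow).
  exact: (continuous_subspaceT ce).
have DG (s : R) : 0 < s -> is_derive s 1 (fun s => - (moment n.+1 s * expR (- k * s)))
    (- (moment n.+1 s * (- k * expR (- k * s)) + expR (- k * s) * flux n s)).
  by move=> s0; exact: is_deriveN (is_deriveM (moment_derive n s0) (De s)).
have G0 (s : R) : 0 < s ->
    0 <= - (moment n.+1 s * (- k * expR (- k * s)) + expR (- k * s) * flux n s).
  move=> s0; have := flux_le on (ltW s0); rewrite -/k => h.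
  have -> : - (moment n.+1 s * (- k * expR (- k * s)) + expR (- k * s) * flux n s) =
      expR (- k * s) * (k * moment n.+1 s - flux n s) by ring.
  by rewrite mulr_ge0 ?expR_ge0// subr_ge0.
have := halfline_nondecreasing cG DG G0 t0.
rewrite lerN2 mulr0 expR0 mulr1 mulNr expRN ler_pdivrMr ?expR_gt0// => /le_trans; apply.
rewrite ler_wpM2r ?expR_ge0//; apply: le_trans (ler_norm _) _.
apply: norm_Kint_le => //; first exact: weak_solution_supported f1sol _ (lexx 0).
move=> [w [p q]] [/= w1 _]; rewrite normrX lerXn2r ?nnegrE//.
apply: le_trans (ler_normB _ _) _; rewrite -[2](_ : 1 + 1 = _)//.
by rewrite lerD// ler_norml.
Qed.

Lemma mean_deviation_decay t : 0 <= t ->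
  \int[f1 t]_(x in K) `|x.1 - w0| <= 4 * expR (- (lambda * t)).
Proof.
move=> t0; set A := Rintegral _ _ _.
have cn : cmeas (fun x : state R => `|x.1 - w0|) by exact: cmeas_norm.
have A0 : 0 <= A by exact: Rintegral_ge0.
pose n := (Num.truncn (expR t)).*2.+1.
have on : odd n by rewrite /n /= odd_double.
have sK := weak_solution_supported f1sol t0.
have et : expR t <= 2 ^+ n.+1.
  apply: le_trans (ltW (truncnS_gt _)) _; rewrite -natrX ler_nat.
  apply: leq_trans (ltnW (ltn_expl _ (leqnn 2))) _.
  by rewrite leq_exp2l// /n ltnS leqW// -addnn leq_addr.
have AM : A ^+ n.+1 <= moment n.+1 t.
  have : n.+1%:R * A ^+ n.+1 <= moment n.+1 t + n%:R * A ^+ n.+1.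
    have -> : n.+1%:R * A ^+ n.+1 =
        \int[f1 t]_(x in K) (n.+1%:R * A ^+ n * `|x.1 - w0|).
      by rewrite KintZ// exprSr mulrA.
    have -> : moment n.+1 t + n%:R * A ^+ n.+1 =
        \int[f1 t]_(x in K) ((x.1 - w0) ^+ n.+1 + n%:R * A ^+ n.+1).
      by rewrite KintD ?Kint_cst//; [exact: cmeasX|exact: cmeas_cst].
    apply: le_Kint.
    - by apply: cmeasM cn; exact: cmeas_cst.
    - by apply: cmeasD; [exact: cmeasX|exact: cmeas_cst].
    move=> x _; have := young_pow n (normr_ge0 (x.1 - w0)) A0.
    have -> : `|x.1 - w0| ^+ n.+1 = (x.1 - w0) ^+ n.+1.
      by rewrite -normrX ger0_norm// exprn_even_ge0// oddS on.
    by rewrite mulrAC.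
  by rewrite -natr1 mulrDl mul1r addrC lerD2r.
have B0 : 0 <= 4 * expR (- (lambda * t)) by rewrite mulr_ge0// expR_ge0.
rewrite -(@ler_pXn2r _ n.+1)// ?nnegrE//.
apply: le_trans AM _; apply: le_trans (moment_le on t0) _.
have -> : (1 - n.+1%:R * lambda) * t = t + n.+1%:R * (- (lambda * t)) by ring.
rewrite expRD expRM_natl mulrA exprMn ler_wpM2r ?exprn_ge0 ?expR_ge0//.
apply: le_trans (ler_wpM2l _ et) _; first by rewrite exprn_ge0.
by rewrite -exprMn -natrM.
Qed.

End moment_decay.

Theorem mainTheorem1 (R : realType) (alpha0 eps0 : R)
    (f00 f01 f0 : probability (R * (R * R))%type R)
    (f f1 : R -> probability (R * (R * R))%type R) :
  0 < alpha0 <= 1 ->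
  0 < eps0 ->
  supported_in f00 K ->
  supported_in f01 K ->
  supported_in f00 [set x | x.2.2 = 0] ->
  supported_in f01 [set x | eps0 <= x.2.2] ->
  mixture alpha0 f00 f01 f0 ->
  0 < mean_p f00 ->
  (exists2 kappa : R * R -> probability R R,
     is_conditional f01 (`[0, 1] `*` `[eps0, 1]) kappa &
     exists2 L : R, 0 < L &
       forall p q p' q' : R,
         0 <= p <= 1 -> eps0 <= q <= 1 -> 0 <= p' <= 1 -> eps0 <= q' <= 1 ->
         (W1 dist1 (kappa (p, q)) (kappa (p', q')) <=
            (L * (`|q - q'| + `|p - p'|))%:E)%E) ->
  transport_solution f0 f ->
  nonstubborn_part f0 f f01 f1 ->
  forall t : R, 0 <= t ->
    (W1 dist3 (f1 t)
        (dirac (weighted_opinion (mean_p f00) f00) \x marginal_pq f01) <=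
     (4 * expR (- (alpha0 * eps0 * mean_p f00 * t)))%:E)%E.
Proof.
move=> /andP[a0 a1] e0 s00 s01 s00q s01q mix P00 _ fsol f1sol t t0.
have a01 : 0 <= alpha0 <= 1 by rewrite ltW.
have cw := @cmeas_w R; have cp := @cmeas_p R; have cpw := cmeasM cp cw.
have P1_ge0 : 0 <= mean_p f01.
  by apply: Rintegral_ge0 => -[w [p q]] [_ [/andP[]]].
have cE : mean_p f0 = alpha0 * mean_p f00 + (1 - alpha0) * mean_p f01.
  exact: Kint_mixture.
set c := mean_p f0 in cE fsol f1sol.
have c0 : 0 < c.
  by rewrite cE ltr_pwDl ?mulr_gt0// mulr_ge0// subr_ge0.
rewrite /transport_solution -/c in fsol.
rewrite /nonstubborn_part -/c in f1sol.
have woE k (mu : probability (state R) R) :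
    weighted_opinion k mu = k^-1 * \int[mu]_(x in K) (x.2.1 * x.1).
  rewrite -KintZ//; apply: eq_Rintegral => x _; by rewrite mulrAC mulrC.
set m := (fun t => weighted_opinion c (f t)) in fsol f1sol.
have cm : {within `[0, +oo[, continuous m}.
  have cwc : cmeas (fun x : state R => x.2.1 / c * x.1).
    by apply: cmeasM cw; apply: cmeasM cp (cmeas_cst _).
  exact: weak_curve_continuous (proj1 fsol) cwc.
set w0 := weighted_opinion (mean_p f00) f00.
have marg s : 0 <= s ->
    forall A, measurable A -> marginal_pq (f1 s) A = marginal_pq f01 A.
  move=> s0; apply: marginal_pq_unique => //.
    exact: weak_solution_supported f1sol _ s0.
  by move=> b d sb sd; exact: weak_solution_pq f1sol _ _ _ sb sd s0.
have f1q s : 0 <= s -> supported_in (f1 s) [set x | eps0 <= x.2.2].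
  move=> s0; pose B : set (R * R) := ~` [set y | eps0 <= y.2].
  have mB : measurable B.
    apply: measurableC.
    have := @measurable_snd _ _ R R measurableT _ (measurable_itv `[eps0, +oo[).
    rewrite setTI; congr (measurable _).
    by apply/seteqP; split => x /=; rewrite in_itv /= andbT.
  exact: (etrans (marg s s0 B mB) s01q).
have Pw0 : mean_p f00 * w0 = \int[f00]_(x in K) (x.2.1 * x.1).
  by rewrite /w0 woE mulVKf// gt_eqF.
have w01 : `|w0| <= 1.
  rewrite -(ler_pM2l P00) mulr1 -[X in X * _](gtr0_norm P00) -normrM Pw0.
  apply: le_trans (le_normr_Rintegral (@K_measurable R) (integrable_cmeas f00 cpw)) _.
  apply: le_Kint => //; first exact: cmeas_norm.
  move=> [w [p q]] [/= w1 [/andP[p0 _] _]]; rewrite normrM ger0_norm//.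
  by rewrite ler_piMr// ler_norml.
have sK := weak_solution_supported f1sol t0.
apply: (le_trans (W1_dirac_prod_le w0 sK (marg t t0))).
rewrite lee_fin.
apply: (mean_deviation_decay a01 (ltW P00) w01 erefl cE cm f1sol f1q) => //.
move=> s s0.
have P1s : \int[f1 s]_(x in K) x.2.1 = mean_p f01.
  by rewrite -(weak_solution_mean_p f1sol s0).
have -> : \int[f1 s]_(x in K) (x.2.1 * (x.1 - w0)) =
    \int[f1 s]_(x in K) (x.2.1 * x.1) - w0 * mean_p f01.
  rewrite -P1s -KintZ// -KintB//; last exact: cmeasM (cmeas_cst _) cp.
  by apply: eq_Rintegral => x _; ring.
have cmE : c * m s = \int[f s]_(x in K) (x.2.1 * x.1).
  by rewrite /m woE mulVKf// gt_eqF.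
rewrite mulrBr cmE (momentum_decomposition a01 c0 s00 s00q mix cm fsol f1sol s0).
by rewrite -Pw0 cE; ring.
Qed.
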